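(* Let $U$ be a finite set and let $\mu,\nu$ be probability distributions on $2^U$ with $\operatorname{supp}(\nu)\subseteq\operatorname{supp}(\mu)$. Let $P_\mu$ (resp. $P_\nu$) be the transition kernel of a Markov chain on $\operatorname{supp}(\mu)$ (resp. $\operatorname{supp}(\nu)$) with stationary distribution $\mu$ (resp. $\nu$), and assume $P_\mu$ is irreducible and reversible w.r.t. $\mu$. Let $(X^{(t)},Y^{(t)})_{t\ge0}$ be any coupling of two copies of the Markov chain $P_\mu$. Then both $$\sum_{j\in U}\Big|\Pr_{S\sim\mu}[j\in S]-\Pr_{S\sim\nu}[j\in S]\Big| \quad\text{and}\quad W_1(\mu,\nu)$$ are bounded above by $$\mathbb{E}_{S\sim\nu}\Big[\sum_{T\neq S}\big|P_\mu(S\to T)-P_\nu(S\to T)\big|\cdot\sum_{t=0}^\infty\mathbb{E}\big[d_H(X^{(t)},Y^{(t)})\mid X^{(0)}=S,\,Y^{(0)}=T\big]\Big].$$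
   Context: $d_H(S,T)=|S\triangle T|$ is the Hamming distance on $2^U$. $W_1(\mu,\nu)=\sup_f|\mathbb{E}_\mu f-\mathbb{E}_\nu f|$ over functions $f:2^U\to\mathbb{R}$ that are $1$-Lipschitz w.r.t. $d_H$. Transition probabilities $P_\nu(S\to T)$ with $T\notin\operatorname{supp}(\nu)$ are $0$. *)

(* Defs.v *)
From HB Require Import structures.
From mathcomp Require Import all_boot all_order all_algebra.
From mathcomp Require Import all_classical all_reals all_analysis.

Set Implicit Arguments.
Unset Strict Implicit.
Unset Printing Implicit Defensive.

Import Order.TTheory GRing.Theory Num.Theory.

Local Open Scope classical_set_scope.
Local Open Scope ring_scope.

(* Probability distributions on a finite type are represented by their
   probability mass functions. *)
Definition is_dist (R : realType) (E : finType) (mu : E -> R) : Prop :=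
  (forall x, 0 <= mu x) /\ \sum_x mu x = 1.

Definition supp (R : realType) (E : finType) (mu : E -> R) : {set E} :=
  [set x | mu x != 0]%SET.

Definition mean (R : realType) (E : finType) (mu : E -> R) (f : E -> R) : R :=
  \sum_x mu x * f x.

(* A kernel on [A] is a total function [E -> E -> R]; its rows outside [A] are
   irrelevant, and from [A] it gives no mass to points outside [A]. *)
Definition is_kernel_on (R : realType) (E : finType) (A : {set E})
    (P : E -> E -> R) : Prop :=
  forall x, x \in A ->
    [/\ forall y, 0 <= P x y,
        forall y, y \notin A -> P x y = 0
      & \sum_y P x y = 1].

Definition stationary (R : realType) (E : finType) (mu : E -> R)
    (P : E -> E -> R) : Prop :=
  forall y, \sum_x mu x * P x y = mu y.

Definition reversible_on (R : realType) (E : finType) (A : {set E})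
    (mu : E -> R) (P : E -> E -> R) : Prop :=
  forall x y, x \in A -> y \in A -> mu x * P x y = mu y * P y x.

Fixpoint kernel_iter (R : realType) (E : finType) (P : E -> E -> R) (n : nat)
    (x y : E) : R :=
  if n is m.+1 then \sum_z P x z * kernel_iter P m z y else (x == y)%:R.

Definition irreducible_on (R : realType) (E : finType) (A : {set E})
    (P : E -> E -> R) : Prop :=
  forall x y, x \in A -> y \in A -> exists n, 0 < kernel_iter P n x y.

(* [X] is a time-homogeneous Markov chain with kernel [P] started at [x0]; the
   Markov property
     Pr[X_(n+1) = s_(n+1) | X_0 = s_0, ..., X_n = s_n] = P s_n s_(n+1)
   is multiplied out so as to also cover null histories. *)
Definition markov_chain_from (R : realType) (E : finType) (d : measure_display)
    (Omega : measurableType d) (Pr : probability Omega R)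
    (P : E -> E -> R) (x0 : E) (X : nat -> Omega -> E) : Prop :=
  Pr [set w | X 0%N w = x0] = 1%E /\
  forall (n : nat) (s : nat -> E),
    Pr [set w | forall i, (i <= n.+1)%N -> X i w = s i] =
    (Pr [set w | forall i, (i <= n)%N -> X i w = s i]
      * (P (s n) (s n.+1))%:E)%E.

(* A coupling of two copies of the chain [P] on [A] is given by its laws
   [Pr x y], one for each pair of starting states, under which [X] and [Y] are
   (marginally) Markov chains with kernel [P] started at [x] and at [y].  The
   pair [(X, Y)] need not be Markov.  Conditioning on
   [X_0 = x, Y_0 = y] means working under [Pr x y]. *)
Definition is_coupling_on (R : realType) (E : finType) (A : {set E})
    (P : E -> E -> R) (d : measure_display) (Omega : measurableType d)
    (Pr : E -> E -> probability Omega R) (X Y : nat -> Omega -> E) : Prop :=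
  (forall t x, measurable [set w | X t w = x]) /\
  (forall t x, measurable [set w | Y t w = x]) /\
  forall x y, x \in A -> y \in A ->
    markov_chain_from (Pr x y) P x X /\ markov_chain_from (Pr x y) P y Y.

Definition hamming (U : finType) (S T : {set U}) : nat :=
  #|(S :\: T) :|: (T :\: S)|%SET.

Definition lipschitz1 (R : realType) (U : finType) (f : {set U} -> R) : Prop :=
  forall S T : {set U}, `|f S - f T| <= (hamming S T)%:R.

Definition W1 (R : realType) (U : finType) (mu nu : {set U} -> R) : \bar R :=
  ereal_sup [set (`|mean mu f - mean nu f|)%:E | f in @lipschitz1 R U].

Definition marginal (R : realType) (U : finType) (mu : {set U} -> R) (j : U)
    : R :=
  \sum_(S : {set U} | j \in S) mu S.

(* The series may diverge; the bound is then infinite unless all the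
   corresponding weights vanish (with [0 * +oo = 0]). *)
Definition coupling_bound (R : realType) (U : finType) (nu : {set U} -> R)
    (Pmu Pnu : {set U} -> {set U} -> R) (d : measure_display)
    (Omega : measurableType d)
    (Pr : {set U} -> {set U} -> probability Omega R)
    (X Y : nat -> Omega -> {set U}) : \bar R :=
  (\sum_(S : {set U}) (nu S)%:E *
     \sum_(T : {set U} | T != S)
       (`|Pmu S T - Pnu S T|%R)%:E *
       \sum_(0 <= t <oo)
         'E_(Pr S T)[fun w => (hamming (X t w) (Y t w))%:R])%E.

(* Main.v *)
(** For [f] 1-Lipschitz put [h = \sum_(t < n) Pmu^t f].  Stationarity of [nu]
    under [Pnu] gives
    [mean nu (Pmu^n f) - mean nu f = mean nu (Pmu h - Pnu h)], and both kernels
    having unit row sums, [(Pmu h - Pnu h) S] is the sum over [T != S] of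
    [(Pmu S T - Pnu S T) * (h T - h S)], where the coupling bounds
    [|h T - h S|] by the sum of the expected distances up to time [n].  It
    remains to replace [Pmu^n f] by [mean mu f]: a solution [g] of the Poisson
    equation [g - Pmu g = f - mean mu f] makes the Cesàro means of [Pmu^n f]
    converge to [mean mu f], even for a periodic chain.  The marginals are
    handled by the 1-Lipschitz function [S |-> \sum_(j in S) s j] for a suitable
    choice of signs [s j]. *)
Require Import Defs.
From HB Require Import structures.
From mathcomp Require Import all_boot all_order all_algebra.
From mathcomp Require Import all_classical all_reals all_analysis.
From mathcomp Require Import measurable_realfun ring.

Set Implicit Arguments.
Unset Strict Implicit.
Unset Printing Implicit Defensive.

Import Order.TTheory GRing.Theory Num.Theory.

Local Open Scope ring_scope.

(** * Averages and kernel operators on a finite type *)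

Definition kernel_op (R : realType) (E : finType) (P : E -> E -> R)
    (f : E -> R) : E -> R :=
  fun x => mean (P x) f.

Section Mean.
Variables (R : realType) (E : finType).
Implicit Types (p q f g : E -> R).

Lemma meanD p f g : mean p (fun x => f x + g x) = mean p f + mean p g.
Proof. by rewrite -big_split; apply: eq_bigr => x _; rewrite mulrDr. Qed.

Lemma meanB p f g : mean p (fun x => f x - g x) = mean p f - mean p g.
Proof. by rewrite -sumrB; apply: eq_bigr => x _; rewrite mulrBr. Qed.

Lemma mean_sum p (n : nat) (f : nat -> E -> R) :
  mean p (fun x => \sum_(t < n) f t x) = \sum_(t < n) mean p (f t).
Proof. by rewrite exchange_big; apply: eq_bigr => x _; rewrite mulr_sumr. Qed.

Lemma mean_cst p (c : R) : \sum_x p x = 1 -> mean p (fun=> c) = c.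
Proof. by move=> p1; rewrite /mean -mulr_suml p1 mul1r. Qed.

Lemma eq_mean_supp p f g :
  (forall x, p x != 0 -> f x = g x) -> mean p f = mean p g.
Proof.
move=> fg; apply: eq_bigr => x _.
by have [->|/fg ->] := eqVneq (p x) 0; rewrite ?mul0r.
Qed.

Lemma ler_norm_mean p f : (forall x, 0 <= p x) ->
  `|mean p f| <= mean p (fun x => `|f x|).
Proof.
move=> p0; apply: le_trans (ler_norm_sum _ _ _) _; apply: ler_sum => x _.
by rewrite normrM (ger0_norm (p0 x)).
Qed.

Lemma ler_mean p f g : (forall x, 0 <= p x) ->
  (forall x, p x != 0 -> f x <= g x) -> mean p f <= mean p g.
Proof.
move=> p0 fg; apply: ler_sum => x _.
have [->|/fg fgx] := eqVneq (p x) 0; first by rewrite !mul0r.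
exact: ler_wpM2l.
Qed.

End Mean.

(** * Harmonic functions and the Poisson equation of a reversible chain *)

Section Poisson.
Variables (R : realType) (E : finType) (mu : E -> R) (P : E -> E -> R).
Hypotheses (mu_dist : is_dist mu) (P_ker : is_kernel_on (supp mu) P)
  (P_stat : stationary mu P).
Let K := kernel_op P.

Lemma in_supp x : (x \in supp mu) = (mu x != 0).
Proof. by rewrite inE. Qed.

Lemma kernel_supp x y : x \in supp mu -> P x y != 0 -> y \in supp mu.
Proof. by move=> /P_ker[_ P0 _]; apply: contraR => /P0 ->. Qed.

(* The Dirichlet form of a function with [mu x * (h - K h) x = 0] vanishes. *)
Lemma harmonic_step (h : E -> R) : (forall x, x \in supp mu -> K h x = h x) ->
  forall x y, x \in supp mu -> 0 < P x y -> h x = h y.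
Proof.
move=> hK x y xA Pxy.
pose F x y := mu x * P x y * (h x - h y) ^+ 2.
have F0 u v : 0 <= F u v.
  rewrite /F; have [mu0|] := eqVneq (mu u) 0; first by rewrite mu0 !mul0r.
  rewrite -in_supp => /P_ker[P0 _ _].
  by rewrite mulr_ge0 ?sqr_ge0 // mulr_ge0 //; exact: mu_dist.1.
have rowE u : \sum_v F u v = mu u * K (fun v => h v ^+ 2) u - mu u * h u ^+ 2.
  have [mu0|] := eqVneq (mu u) 0.
    by rewrite mu0 !mul0r subr0 big1 // => v _; rewrite /F mu0 !mul0r.
  rewrite -in_supp => uA; have [_ _ P1] := P_ker uA.
  (* The square is expanded; by the unit row sum and [K h u = h u], the first two terms combine to
     [- (mu u * h u ^+ 2)]. *)
  transitivity (mu u * h u ^+ 2 * (\sum_v P u v) - 2 * mu u * h u * K h u +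
                mu u * K (fun v => h v ^+ 2) u); last first.
    by rewrite P1 hK //; ring.
  rewrite /K /kernel_op /mean !mulr_sumr -sumrB -big_split /=.
  by apply: eq_bigr => v _; rewrite /F; ring.
(* By stationarity [K (h ^ 2)] and [h ^ 2] have the same mean under [mu], so the row sums cancel in
   total. *)
have Fsum0 : \sum_u \sum_v F u v = 0.
  under eq_bigr do rewrite rowE.
  rewrite sumrB; apply/eqP; rewrite subr_eq0; apply/eqP.
  under eq_bigr do rewrite /K /kernel_op /mean mulr_sumr.
  rewrite exchange_big; apply: eq_bigr => v _ /=.
  by rewrite -P_stat mulr_suml; apply: eq_bigr => u _; rewrite mulrA.
have Fx0 : \sum_v F x v = 0.
  by apply: (psumr_eq0P _ Fsum0) => // u _; exact: sumr_ge0.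
have /eqP : F x y = 0 by apply: (psumr_eq0P _ Fx0).
rewrite /F !mulf_eq0 orbb subr_eq0 (gt_eqF Pxy) orbF.
by move: xA; rewrite in_supp => /negPf -> /= /eqP.
Qed.

(** Induction on [n]: positive mass at time [n.+1] passes through some [z] with [P x z] and
    [kernel_iter P n z y] both positive, and [harmonic_step] handles the first move. With
    irreducibility, harmonic functions are constant on [supp mu]. *)
Lemma harmonic_iter (h : E -> R) :
  (forall x, x \in supp mu -> K h x = h x) ->
  forall n x y, x \in supp mu -> 0 < kernel_iter P n x y -> h x = h y.
Proof.
move=> hK; elim=> [|n IH] x y xA /=.
  by case: eqVneq => [->//|_]; rewrite ltxx.
move=> /lt0r_neq0 /eqP.
have [P0 Pout _] := P_ker xA.
have [/existsP[z /andP[Pz Iz]] _|] :=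
  boolP [exists z, (0 < P x z) && (0 < kernel_iter P n z y)].
  have zA : z \in supp mu by apply: kernel_supp xA _; rewrite gt_eqF.
  by rewrite (harmonic_step hK xA Pz); exact: IH.
move=> /existsPn nex []; apply: big1 => z _.
have [->|Pxz] := eqVneq (P x z) 0; first by rewrite mul0r.
have zA := kernel_supp xA Pxz.
(* Rows of [P] outside [supp mu] may be negative, so the induction has to stay inside the
   support. *)
have I0 m u : u \in supp mu -> 0 <= kernel_iter P m u y.
  elim: m u => [|m IHm] u uA /=; first exact: ler0n.
  apply: sumr_ge0 => v _; have [Pu0 _ _] := P_ker uA.
  have [->|Puv] := eqVneq (P u v) 0; first by rewrite mul0r.
  by rewrite mulr_ge0 // IHm // (kernel_supp uA Puv).
have := nex z; rewrite lt0r Pxz P0 /= lt0r I0 // andbT negbK => /eqP ->.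
by rewrite mulr0.
Qed.

Hypotheses (P_irr : irreducible_on (supp mu) P)
  (P_rev : reversible_on (supp mu) mu P).

(** Outside the support both sides vanish: either both weights are zero, or the kernel gives no mass
    to the point of weight zero. Detailed balance on all of [E] is what makes the matrix [B] below
    symmetric. *)
Lemma mu_reversible x y : mu x * P x y = mu y * P y x.
Proof.
have zero u v : mu u = 0 -> mu u * P u v = mu v * P v u.
  move=> mu0; have [mv0|] := eqVneq (mu v) 0; first by rewrite mu0 mv0 !mul0r.
  rewrite -in_supp => /P_ker[_ Pv0 _].
  by rewrite Pv0 ?mulr0 ?mu0 ?mul0r // in_supp mu0 eqxx.
have [/zero ->//|mx] := eqVneq (mu x) 0.
have [/zero ->//|my] := eqVneq (mu y) 0.
by apply: P_rev; rewrite in_supp.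
Qed.

(* [B = diag mu *m (1 - P)] is symmetric and its kernel consists of functions
   constant on [supp mu]; hence a vector lies in its image as soon as it is
   orthogonal to constants. *)
Lemma poisson_equation (f : E -> R) : exists g : E -> R,
  forall x, x \in supp mu -> g x - K g x = f x - mean mu f.
Proof.
pose c := mean mu f.
pose e (i : 'I_#|E|) : E := enum_val i.
pose B : 'M[R]_#|E| :=
  \matrix_(i, j) (mu (e i) * ((e i == e j)%:R - P (e i) (e j))).
pose w : 'rV[R]_#|E| := \row_j (mu (e j) * (f (e j) - c)).
have sumE (F : E -> R) : \sum_(i < #|E|) F (e i) = \sum_x F x.
  by rewrite [RHS](reindex e) //; exact/onW_bij/enum_val_bij.
have B_op (h : E -> R) i :
    \sum_j B i j * h (e j) = mu (e i) * (h (e i) - K h (e i)).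
  under eq_bigr do rewrite mxE.
  rewrite (sumE (fun y => mu (e i) * ((e i == y)%:R - P (e i) y) * h y)).
  under eq_bigr do rewrite -mulrA mulrBl.
  rewrite -mulr_sumr sumrB; congr (_ * (_ - _)).
  rewrite (bigD1 (e i)) //= eqxx mul1r big1 ?addr0 // => y /negPf.
  by rewrite eq_sym => ->; rewrite mul0r.
have B_sym i j : B i j = B j i.
  rewrite !mxE !mulrBr mu_reversible eq_sym.
  by case: eqVneq => [->//|_]; rewrite !mulr0.
have : (w <= B)%MS.
  rewrite submxE; apply/eqP/rowP => j; rewrite !mxE.
  (* A column of [cokermx B], read as a function on [E], is annihilated by [B] and hence harmonic on
     [supp mu]; [w] must be orthogonal to it. *)
  pose h x := cokermx B (enum_rank x) j.
  have he i : cokermx B i j = h (e i) by rewrite /h /e enum_valK.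
  have hK x : x \in supp mu -> K h x = h x.
    rewrite in_supp => mx.
    have /matrixP/(_ (enum_rank x) j) := mulmx_coker B.
    rewrite !mxE; under eq_bigr do rewrite he.
    rewrite B_op /e enum_rankK => /eqP.
    by rewrite mulf_eq0 (negPf mx) /= subr_eq0 => /eqP.
  have [x0 mx0] : exists x0, mu x0 != 0.
    apply/existsP; apply: contraT => /existsPn mu0.
    have := mu_dist.2; rewrite big1 => [/esym/eqP|x _]; first by rewrite oner_eq0.
    by apply/eqP; rewrite -[_ == _]negbK.
  have h_cst x : mu x != 0 -> h x = h x0.
    move=> mx; have [||n] := P_irr (x := x) (y := x0); rewrite ?in_supp //.
    by apply: harmonic_iter hK _ _ _ _; rewrite in_supp.
  under eq_bigr do rewrite he mxE.
  rewrite (sumE (fun x => mu x * (f x - c) * h x)).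
  transitivity (mean mu (fun x => (f x - c) * h x0)).
    rewrite -[LHS]/(\sum_x _); apply: eq_bigr => x _; rewrite -mulrA.
    by have [->|/h_cst ->] := eqVneq (mu x) 0; rewrite ?mul0r.
  transitivity (mean mu (fun x => f x - c) * h x0).
    by rewrite /mean mulr_suml; apply: eq_bigr => x _; rewrite mulrA.
  by rewrite meanB mean_cst ?mu_dist.2 // subrr mul0r.
move=> /submxP[v /rowP vB].
exists (fun x => v 0 (enum_rank x)) => x; rewrite in_supp => mx.
have := vB (enum_rank x); rewrite !mxE.
(* Symmetry turns the row combination [v *m B] into [B] acting on [v] as a function. *)
have -> : \sum_j v 0 j * B j (enum_rank x) =
    \sum_j B (enum_rank x) j * v 0 (enum_rank (e j)).
  by apply: eq_bigr => j _; rewrite B_sym mulrC /e enum_valK.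
rewrite (B_op (fun x => v 0 (enum_rank x))) /e enum_rankK.
by move/(mulfI mx).
Qed.

Lemma kernel_op_ext (f g : E -> R) :
  (forall x, x \in supp mu -> f x = g x) ->
  forall x, x \in supp mu -> K f x = K g x.
Proof.
move=> fg x xA; apply: eq_mean_supp => y Pxy.
exact/fg/(kernel_supp xA).
Qed.

(** Averaging over a probability row cannot increase the supremum over [supp mu], and rows from the
    support never leave it. *)
Lemma norm_iter_kernel_op (g : E -> R) (G : R) : (forall x, `|g x| <= G) ->
  forall n x, x \in supp mu -> `|iter n K g x| <= G.
Proof.
move=> gG; elim=> [|n IH] x xA //=.
have [P0 _ P1] := P_ker xA.
apply: le_trans (ler_norm_mean _ P0) _.
rewrite -[leRHS](mean_cst G P1); apply: ler_mean => // y Pxy.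
exact/IH/(kernel_supp xA).
Qed.

(** Applying [K] repeatedly to the Poisson equation makes each [iter t K f - mean mu f] a difference
    of consecutive iterates of [g]; the sum telescopes to [g - iter n K g], which is bounded
    independently of [n]. *)
Lemma sum_iter_bounded (f : E -> R) : exists2 G : R, 0 <= G &
  forall n x, x \in supp mu ->
    `|\sum_(t < n) iter t K f x - n%:R * mean mu f| <= G.
Proof.
have [g gP] := poisson_equation f.
pose c := mean mu f.
have iterE t x : x \in supp mu ->
    iter t K f x = iter t K g x - iter t.+1 K g x + c.
  elim: t x => [|t IH] x xA; first by rewrite /= gP // subrK.
  rewrite iterS (kernel_op_ext IH xA) /K /kernel_op meanD meanB.
  by rewrite mean_cst //; have [] := P_ker xA.
pose G := \sum_x `|g x|.
have gG x : `|g x| <= G by rewrite /G (bigD1 x) //= lerDl sumr_ge0.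
exists (G + G) => [|n x xA]; first by rewrite addr_ge0 // sumr_ge0.
have -> : \sum_(t < n) iter t K f x = g x - iter n K g x + n%:R * c.
  elim: n => [|n IH]; first by rewrite big_ord0 subrr mul0r addr0.
  by rewrite big_ord_recr /= IH iterE // -natr1 /=; ring.
rewrite addrK; apply: le_trans (ler_normB _ _) _.
by rewrite lerD // norm_iter_kernel_op.
Qed.

End Poisson.

(** * Comparison of the two stationary means *)

Section Comparison.
Variables (R : realType) (E : finType) (mu nu : E -> R) (P Q : E -> E -> R).
Hypotheses (nu_dist : is_dist nu) (supp_nu_mu : supp nu \subset supp mu).
Hypotheses (P_ker : is_kernel_on (supp mu) P) (Q_ker : is_kernel_on (supp nu) Q)
  (Q_stat : stationary nu Q).
Let K := kernel_op P.

Variables (f : E -> R) (D : nat -> E -> E -> R).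
Hypothesis iterD : forall t x y, x \in supp mu -> y \in supp mu ->
  `|iter t K f x - iter t K f y| <= D t x y.

(** The coupling bound with its series cut off at time [n]; [D t x y] stands for the expected
    distance at time [t] from the starting pair [(x, y)]. *)
Definition partial_bound (n : nat) : R :=
  mean nu (fun x => \sum_(y | y != x) `|P x y - Q x y| * \sum_(t < n) D t x y).

(* For [h = \sum_(t < n) P^t f], the left-hand side is
   [mean nu (P h - h) = mean nu (P h - Q h)] by stationarity of [nu]. *)
Lemma iter_drift_bound n :
  `|mean nu (iter n K f) - mean nu f| <= partial_bound n.
Proof.
pose h x := \sum_(t < n) iter t K f x.
have telescope x : iter n K f x - f x = K h x - h x.
  rewrite /K /kernel_op mean_sum -/K -[f x]/(iter 0 K f x).
  rewrite -(telescope_sumr (fun t => iter t K f x)) // big_mkord sumrB.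
  by congr (_ - _).
have Q_mean : mean nu (kernel_op Q h) = mean nu h.
  rewrite [LHS]/mean; under eq_bigr do rewrite /kernel_op /mean mulr_sumr.
  rewrite exchange_big; apply: eq_bigr => y _ /=.
  by rewrite -Q_stat mulr_suml; apply: eq_bigr => x _; rewrite mulrA.
have -> : mean nu (iter n K f) - mean nu f =
    mean nu (fun x => K h x - kernel_op Q h x).
  rewrite [RHS]meanB Q_mean -!meanB.
  by apply: eq_bigr => x _; rewrite telescope.
apply: le_trans (ler_norm_mean _ nu_dist.1) _.
apply: ler_mean nu_dist.1 _ => x nux.
have xnu : x \in supp nu by rewrite in_supp.
have xmu := fintype.subsetP supp_nu_mu x xnu.
have [_ Pout P1] := P_ker xmu; have [_ Qout Q1] := Q_ker xnu.
have -> : K h x - kernel_op Q h x =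
    \sum_(y | y != x) (P x y - Q x y) * (h y - h x).
  transitivity (\sum_y (P x y - Q x y) * (h y - h x)); last first.
    by rewrite (bigD1 x) //= subrr mulr0 add0r.
  under [RHS]eq_bigr do rewrite mulrBr mulrBl.
  by rewrite !sumrB -mulr_suml sumrB P1 Q1 subrr mul0r subr0.
apply: le_trans (ler_norm_sum _ _ _) _; apply: ler_sum => y _; rewrite normrM.
(* [iterD] is available only on [supp mu]; outside it both kernels vanish, so a nonzero difference
   forces [y] into the support. *)
have [->|PQ] := eqVneq (P x y - Q x y) 0; first by rewrite normr0 !mul0r.
apply: ler_wpM2l => //.
have ymu : y \in supp mu.
  apply: contraNT PQ => ymu; rewrite Pout // Qout ?subrr //.
  by apply: contraNN ymu; exact: (fintype.subsetP supp_nu_mu).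
rewrite distrC -sumrB; apply: le_trans (ler_norm_sum _ _ _) _.
by apply: ler_sum => t _; exact: iterD.
Qed.

Hypotheses (mu_dist : is_dist mu) (P_stat : stationary mu P)
  (P_irr : irreducible_on (supp mu) P)
  (P_rev : reversible_on (supp mu) mu P).

(* [P^t f] need not converge to [mean mu f] (the chain may be periodic), but
   its time averages do. *)
Lemma mean_comparison (b : R) : (forall n, partial_bound n <= b) ->
  `|mean mu f - mean nu f| <= b.
Proof.
move=> bP.
have [G G0 GP] := sum_iter_bounded mu_dist P_ker P_stat P_irr P_rev f.
(* The sum of the first [n] means lies within [n%:R * b] of the [nu] side by the drift bound, and
   within the constant [G] of the [mu] side by the Poisson equation. *)
have le_n (n : nat) : n%:R * `|mean mu f - mean nu f| <= n%:R * b + G.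
  have sum_drift : `|\sum_(t < n) mean nu (iter t K f) - n%:R * mean nu f|
      <= n%:R * b.
    have natE (a : R) : n%:R * a = \sum_(t < n) a.
      by rewrite sumr_const card_ord mulr_natl.
    rewrite !natE -sumrB.
    apply: le_trans (ler_norm_sum _ _ _) _; apply: ler_sum => t _.
    exact: le_trans (iter_drift_bound t) (bP t).
  have average : `|\sum_(t < n) mean nu (iter t K f) - n%:R * mean mu f| <= G.
    rewrite -(mean_sum nu n (fun t => iter t K f)).
    rewrite -(mean_cst (n%:R * mean mu f) nu_dist.2) -meanB.
    apply: le_trans (ler_norm_mean _ nu_dist.1) _.
    rewrite -[leRHS](mean_cst G nu_dist.2).
    apply: ler_mean nu_dist.1 _ => x nux; apply: GP.
    by apply: (fintype.subsetP supp_nu_mu); rewrite in_supp.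
  have -> : n%:R * `|mean mu f - mean nu f| =
      `|n%:R * mean mu f - n%:R * mean nu f|.
    by rewrite -mulrBr normrM normr_nat.
  apply: le_trans (ler_distD (\sum_(t < n) mean nu (iter t K f)) _ _) _.
  by rewrite addrC lerD // distrC.
(* A gap [r > 0] above [b] would give [n%:R * r <= G] for every [n], which fails once [n] exceeds
   [G / r]. *)
rewrite leNgt; apply/negP => b_lt; move: b_lt; rewrite -subr_gt0.
set r := _ - b => r0.
have := archi_boundP (divr_ge0 G0 (ltW r0)); rewrite ltr_pdivrMr //.
by rewrite ltNge /r mulrBr lerBlDl le_n.
Qed.

End Comparison.

(** * Laws of random variables with finitely many values *)

Section Law.
Variables (R : realType) (d : measure_display) (Omega : measurableType d).
Variable (Pr : probability Omega R).
Local Open Scope classical_set_scope.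

Definition law (T : finType) (Z : Omega -> T) (z : T) : R :=
  fine (Pr [set w | Z w = z]).

Lemma law_ge0 (T : finType) (Z : Omega -> T) z : 0 <= law Z z.
Proof. exact/fine_ge0/measure_ge0. Qed.

(** The indicator of [B] is the finite sum of the indicators of its pieces, and integration carries
    this over to probabilities. *)
Lemma probability_split (T : finType) (Z : Omega -> T) (B : set Omega) :
  (forall z, measurable [set w | Z w = z]) -> measurable B ->
  Pr B = (\sum_z Pr (B `&` [set w | Z w = z]))%E.
Proof.
move=> mZ mB; have mBZ z : measurable (B `&` [set w | Z w = z]).
  exact: measurableI.
rewrite -[B in LHS]setIT -(integral_indic Pr measurableT mB).
under [RHS]eq_bigr => z _.
  rewrite -[X in Pr X]setIT -(integral_indic Pr measurableT (mBZ z)); over.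
rewrite -ge0_integral_sum //.
- apply: eq_integral => w _; rewrite sumEFin; congr EFin.
  rewrite (bigD1 (Z w)) //= big1 ?addr0.
    rewrite !indicE; congr ((_ : bool)%:R).
    by apply/idP/idP; rewrite !inE /=; tauto.
  by move=> z /eqP zZ; rewrite indicE memNset // => -[_ /= /esym].
- by move=> z; exact/measurable_EFinP/measurable_indic.
Qed.

Lemma law_split (S T : finType) (Z : Omega -> S) (W : Omega -> T) z :
  (forall z, measurable [set w | Z w = z]) ->
  (forall x, measurable [set w | W w = x]) ->
  law Z z = \sum_x law (fun w => (Z w, W w)) (z, x).
Proof.
move=> mZ mW; apply: EFin_inj; rewrite /law fineK ?fin_num_measure //.
rewrite (probability_split mW) // -sumEFin; apply: eq_bigr => x _.
have -> : [set w | (Z w, W w) = (z, x)] = [set w | Z w = z] `&` [set w | W w = x].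
  by apply/seteqP; split=> w /= => [[->]|[-> ->]].
by rewrite fineK // fin_num_measure //; exact: measurableI.
Qed.

Lemma expectation_law (T : finType) (Z : Omega -> T) (phi : T -> R) :
  (forall z, measurable [set w | Z w = z]) -> (forall z, 0 <= phi z) ->
  'E_Pr[fun w => phi (Z w)]%E = (mean (law Z) phi)%:E.
Proof.
move=> mZ phi0; rewrite unlock.
transitivity (\int[Pr]_w
    (\sum_z (phi z)%:E * (\1_[set v | Z v = z] w)%:E))%E.
  apply: eq_integral => w _; under eq_bigr do rewrite -EFinM.
  rewrite sumEFin (bigD1 (Z w)) //= big1 ?addr0.
    by rewrite indicE mem_set // mulr1.
  by move=> z /eqP zZ; rewrite indicE memNset ?mulr0 // => /= /esym.
have mind z : measurable_fun setT (fun w => (\1_[set v | Z v = z] w : R)%:E).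
  exact/measurable_EFinP/measurable_indic.
rewrite ge0_integral_sum //.
- rewrite /mean -sumEFin; apply: eq_bigr => z _.
  rewrite ge0_integralZl_EFin //.
  by rewrite integral_indic // setIT EFinM /law fineK ?fin_num_measure // muleC.
- by move=> z; exact: measurable_funeM.
- by move=> z w _; rewrite -EFinM lee_fin mulr_ge0.
Qed.

(** Both means can be taken under the joint law, whose marginals are [law Z] and [law W]; this is
    the easy half of Kantorovich duality. *)
Lemma mean_law_dist (S T : finType) (Z : Omega -> S) (W : Omega -> T)
    (f : S -> R) (g : T -> R) (c : S * T -> R) :
  (forall z, measurable [set w | Z w = z]) ->
  (forall x, measurable [set w | W w = x]) ->
  (forall z x, `|f z - g x| <= c (z, x)) ->
  `|mean (law Z) f - mean (law W) g| <= mean (law (fun w => (Z w, W w))) c.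
Proof.
move=> mZ mW fgc.
have -> : mean (law Z) f = mean (law (fun w => (Z w, W w))) (fun p => f p.1).
  transitivity (\sum_z \sum_x law (fun w => (Z w, W w)) (z, x) * f z); last first.
    by rewrite pair_bigA; apply: eq_bigr => -[z x].
  by apply: eq_bigr => z _; rewrite (law_split z mZ mW) mulr_suml.
have -> : mean (law W) g = mean (law (fun w => (Z w, W w))) (fun p => g p.2).
  transitivity (\sum_z \sum_x law (fun w => (Z w, W w)) (z, x) * g x); last first.
    by rewrite pair_bigA; apply: eq_bigr => -[z x].
  rewrite exchange_big; apply: eq_bigr => x _ /=.
  rewrite (law_split x mW mZ) mulr_suml; apply: eq_bigr => z _.
  congr (fine (Pr _) * _).
  by apply/seteqP; split=> w /= [-> ->].
rewrite -meanB; apply: le_trans (ler_norm_mean _ (@law_ge0 _ _)) _.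
by apply: ler_mean (@law_ge0 _ _) _ => -[z x] _; exact: fgc.
Qed.

(** * One-time laws of a Markov chain *)

Section MarkovChain.
Variables (E : finType) (P : E -> E -> R) (x0 : E) (X : nat -> Omega -> E).
Hypothesis mX : forall t x, measurable [set w | X t w = x].
Hypothesis X_chain : markov_chain_from Pr P x0 X.

Lemma law0 x : law (X 0%N) x = (x == x0)%:R.
Proof.
have [->|xx0] := eqVneq x x0; first by rewrite /law X_chain.1.
have : Pr (~` [set w | X 0%N w = x0]) = 0%E.
  by rewrite probability_setC // X_chain.1 subee.
move=> null; rewrite /law (_ : Pr _ = 0%E) //; apply/eqP.
rewrite eq_le measure_ge0 andbT -null le_measure ?inE //; first exact: measurableC.
by move=> w /= -> /eqP; rewrite (negPf xx0).
Qed.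

(** The Markov property is stated for whole histories, so the event is split along all paths up to
    time [n], and the paths are then regrouped by their last state. *)
Lemma lawS n y : law (X n.+1) y = \sum_x law (X n) x * P x y.
Proof.
(* As a finite function, the history takes values in a finite type, so [probability_split] applies
   to it. *)
pose path w : {ffun 'I_n.+1 -> E} := [ffun i : 'I_n.+1 => X i w].
have path_eq s : [set w | path w = s] =
    [set w | forall i, (i <= n)%N -> X i w = s (inord i)].
  apply/seteqP; split=> w /= => [<- i le_in|ws].
    by rewrite ffunE inordK.
  by apply/ffunP => i; rewrite ffunE ws ?inord_val // -ltnS.
have mpath s : measurable [set w | path w = s].
  rewrite path_eq (_ : [set w | _] =
    \bigcap_(i in [set i | (i <= n)%N]) [set w | X i w = s (inord i)]).
    by apply: bigcap_measurableType => i _.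
  by apply/seteqP; split=> w /=.
have stepE s : Pr ([set w | X n.+1 w = y] `&` [set w | path w = s]) =
    (law path s * P (s ord_max) y)%:E.
  (* The path [s] prolonged by [y]; of the values after [n], only the one at [n.+1] is read. *)
  pose s' i := if (i <= n)%N then s (inord i) else y.
  have := X_chain.2 n s'.
  rewrite (_ : [set w | forall i, (i <= n.+1)%N -> X i w = s' i] =
    [set w | X n.+1 w = y] `&` [set w | path w = s]); last first.
    rewrite path_eq; apply/seteqP; split=> w /= => [ws|[wy ws] i].
      split=> [|i le_in]; first by rewrite ws // /s' ltnn.
      by rewrite ws ?/s' ?le_in // ltnW // ltnS.
    rewrite leq_eqVlt ltnS /s' => /predU1P[->|le_in]; first by rewrite ltnn.
    by rewrite le_in ws.
  rewrite (_ : [set w | forall i, (i <= n)%N -> X i w = s' i] =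
    [set w | path w = s]); last first.
    rewrite path_eq; apply/seteqP; split=> w /= ws i le_in.
      by rewrite ws // /s' le_in.
    by rewrite ws // /s' le_in.
  move=> ->; rewrite /s' leqnn ltnn EFinM /law fineK ?fin_num_measure //.
  congr (_ * (P (s _) _)%:E)%E; apply: val_inj; exact: inordK.
have lastE x : law (X n) x = \sum_(s : {ffun 'I_n.+1 -> E} | s ord_max == x) law path s.
  apply: EFin_inj; rewrite {1}/law fineK ?fin_num_measure //.
  rewrite (probability_split mpath) // -sumEFin [RHS]big_mkcond.
  apply: eq_bigr => s _; have [sx|/eqP sx] := ifPn.
    rewrite /law fineK ?fin_num_measure //; congr (Pr _).
    apply/seteqP; split=> w /= => [[]//|ws]; split=> //.
    by rewrite -(eqP sx) -ws ffunE.
  rewrite (_ : _ `&` _ = set0) ?measure0 //.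
  by apply/seteqP; split=> w //= [wx ws]; case: sx; rewrite -ws ffunE.
transitivity (\sum_s law path s * P (s ord_max) y).
  apply: EFin_inj; rewrite {1}/law fineK ?fin_num_measure //.
  rewrite (probability_split mpath) // -sumEFin.
  by apply: eq_bigr => s _; exact: stepE.
rewrite (partition_big (fun s : {ffun 'I_n.+1 -> E} => s ord_max) xpredT) //=.
apply: eq_bigr => x _; rewrite lastE mulr_suml.
by apply: eq_bigr => s /eqP ->.
Qed.

(** The last transition is absorbed into the function, so the induction is on [t] for all [f] and is
    applied to [kernel_op P f]. *)
Lemma mean_law_chain t (f : E -> R) :
  mean (law (X t)) f = iter t (kernel_op P) f x0.
Proof.
elim: t f => [|t IH] f /=.
  rewrite /mean (bigD1 x0) //= law0 eqxx mul1r big1 ?addr0 // => x /negPf xx0.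
  by rewrite law0 xx0 mul0r.
rewrite -iterS iterSr -IH [LHS]/mean.
under eq_bigr do rewrite lawS mulr_suml.
rewrite exchange_big; apply: eq_bigr => x _ /=; rewrite mulr_sumr.
by apply: eq_bigr => y _; rewrite mulrA.
Qed.

End MarkovChain.
End Law.

(** * Hamming distance and marginals *)

Section Hamming.
Variables (R : realType) (U : finType).

Lemma hammingE (S T : {set U}) :
  (hamming S T)%:R = \sum_j ((j \in S) != (j \in T))%:R :> R.
Proof.
rewrite /hamming -sum1_card natr_sum [RHS]big_mkcond [LHS]big_mkcond /=.
apply: eq_bigr => j _; rewrite !inE.
by case: (j \in S); case: (j \in T).
Qed.

Lemma marginal_distance_W1 (mu nu : {set U} -> R) :
  ((\sum_j `|marginal mu j - marginal nu j|)%:E <= W1 mu nu)%E.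
Proof.
pose s j : R := Num.sg (marginal mu j - marginal nu j).
pose f (S : {set U}) := \sum_(j in S) s j.
have meanE (p : {set U} -> R) : mean p f = \sum_j s j * marginal p j.
  under [RHS]eq_bigr do rewrite /marginal mulr_sumr big_mkcond.
  rewrite exchange_big; apply: eq_bigr => S _ /=.
  rewrite /f big_mkcond mulr_sumr; apply: eq_bigr => j _.
  by case: ifP => _; rewrite ?mulr0 // mulrC.
apply: ereal_sup_ubound; exists f.
  (* Only the elements of the symmetric difference contribute, each by [s j] up to sign, which is at
     most 1 in absolute value. *)
  move=> S T; rewrite hammingE /f [X in `|X - _|]big_mkcond.
  rewrite [X in `|_ - X|]big_mkcond -sumrB.
  apply: le_trans (ler_norm_sum _ _ _) _; apply: ler_sum => j _.
  have s1 : `|s j| <= 1 by rewrite normr_sg; case: (_ != 0).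
  by case: (j \in S); case: (j \in T); rewrite ?subrr ?subr0 ?sub0r ?normrN ?normr0.
congr EFin; rewrite !meanE -sumrB ger0_norm.
  by apply: eq_bigr => j _; rewrite -mulrBr /s -normrEsg.
by apply: sumr_ge0 => j _; rewrite -mulrBr /s -normrEsg.
Qed.

End Hamming.

Theorem theorem1p8 (R : realType) (U : finType) (mu nu : {set U} -> R)
    (Pmu Pnu : {set U} -> {set U} -> R)
    (d : measure_display) (Omega : measurableType d)
    (Pr : {set U} -> {set U} -> probability Omega R)
    (X Y : nat -> Omega -> {set U})
    (mu_dist : is_dist mu) (nu_dist : is_dist nu)
    (supp_nu_mu : supp nu \subset supp mu)
    (Pmu_kernel : is_kernel_on (supp mu) Pmu)
    (Pnu_kernel : is_kernel_on (supp nu) Pnu)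
    (Pmu_stationary : stationary mu Pmu)
    (Pnu_stationary : stationary nu Pnu)
    (Pmu_irreducible : irreducible_on (supp mu) Pmu)
    (Pmu_reversible : reversible_on (supp mu) mu Pmu)
    (XY_coupling : is_coupling_on (supp mu) Pmu Pr X Y) :
  ((\sum_(j : U) `|marginal mu j - marginal nu j|)%:E
     <= coupling_bound nu Pmu Pnu Pr X Y)%E /\
  (W1 mu nu <= coupling_bound nu Pmu Pnu Pr X Y)%E.
Proof.
suff W1_le : (W1 mu nu <= coupling_bound nu Pmu Pnu Pr X Y)%E.
  by split=> //; exact: le_trans (marginal_distance_W1 mu nu) W1_le.
apply: ge_ereal_sup => _ [f f_lip <-].
have [mX [mY XY_chain]] := XY_coupling.
have mXY t z : measurable [set w | (X t w, Y t w) = z]%classic.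
  case: z => x y; rewrite (_ : [set w | _] =
    [set w | X t w = x] `&` [set w | Y t w = y])%classic.
    exact: measurableI.
  by apply/seteqP; split=> w /= => [[->]|[-> ->]].
pose D t S T := mean (law (Pr S T) (fun w => (X t w, Y t w)))
  (fun p => (hamming p.1 p.2)%:R).
have DE S T t : 'E_(Pr S T)[fun w => (hamming (X t w) (Y t w))%:R]%E =
    (D t S T)%:E.
  exact: (expectation_law (Pr S T) (Z := fun w => (X t w, Y t w))
    (phi := fun p => (hamming p.1 p.2)%:R) (mXY t) (fun=> ler0n _ _)).
have iterD t S T : S \in supp mu -> T \in supp mu ->
    `|iter t (kernel_op Pmu) f S - iter t (kernel_op Pmu) f T| <= D t S T.
  move=> SA TA; have [Xch Ych] := XY_chain S T SA TA.
  rewrite -(mean_law_chain mX Xch) -(mean_law_chain mY Ych).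
  by apply: mean_law_dist.
have nu0 := nu_dist.1.
(* Expected distances are nonnegative, so each truncated series is below its possibly infinite
   limit. *)
have bound_ge n :
    ((partial_bound nu Pmu Pnu D n)%:E <= coupling_bound nu Pmu Pnu Pr X Y)%E.
  rewrite /partial_bound /mean -sumEFin; apply: lee_sum => S _.
  rewrite EFinM; apply: lee_wpmul2l; first by rewrite lee_fin.
  rewrite -sumEFin; apply: lee_sum => T _.
  rewrite EFinM; apply: lee_wpmul2l; first by rewrite lee_fin.
  rewrite -sumEFin; under eq_bigr do rewrite -DE.
  rewrite -(big_mkord xpredT
    (fun t => 'E_(Pr S T)[fun w => (hamming (X t w) (Y t w))%:R]%E)).
  by apply: nneseries_lim_ge => t _ _; exact: expectation_ge0.
(* A finite bound dominates every [partial_bound], as [mean_comparison] requires; [+oo] is trivial,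
   and [-oo] contradicts [bound_ge] at 0. *)
case: (coupling_bound _ _ _ _ _ _) bound_ge => [b||] bound_ge.
- rewrite lee_fin; apply: (mean_comparison nu_dist supp_nu_mu Pmu_kernel
    Pnu_kernel Pnu_stationary iterD mu_dist Pmu_stationary Pmu_irreducible
    Pmu_reversible) => n.
  by rewrite -lee_fin; exact: bound_ge.
- exact: leey.
- by have := bound_ge 0%N.
Qed.
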